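(* For every nonempty compact convex set $H\subseteq\mathbb{R}^2$, the slide curve $$\mathrm{Sli}(H)=\{(P,\mathrm{dir}(\ell)) : P\in\partial H,\ \ell \text{ is a (directed) supporting line of } H \text{ with } P\in \ell\}\subseteq \mathbb{R}^2\times C_{\mathrm{unit}}\subseteq\mathbb{R}^4$$ is a rectifiable simple closed curve.
   Context: $C_{\mathrm{unit}}=\{(x,y)\in\mathbb{R}^2 : x^2+y^2=1\}$ is the unit circle, and $\mathbb{R}^2\times C_{\mathrm{unit}}=\{(x,y,z,t)\in\mathbb{R}^4 : z^2+t^2=1\}$, with the Euclidean metric of $\mathbb{R}^4$. $\partial H$ denotes the topological boundary of $H$ in $\mathbb{R}^2$. Convex sets are not assumed to have nonempty interior. Lines are directed. The direction $\mathrm{dir}(\ell)$ of a directed line $\ell$ is regarded as an element of $C_{\mathrm{unit}}$, namely the unit direction vector of $\ell$. A directed line $\ell$ determines a closed left halfplane and a closed right halfplane, whose intersection is $\ell$. A directed line $\ell$ is a supporting line of $H$ if $H$ is contained in the closed left halfplane of $\ell$ and $\ell\cap H\neq\emptyset$. A pointed supporting line of $H$ is a pair $(P,\ell)$ with $P\in\partial H$ and $\ell$ a supporting line of $H$ through $P$; thus $\mathrm{Sli}(H)$ is the set of all $(P,\mathrm{dir}(\ell))$ with $(P,\ell)$ a pointed supporting line of $H$. A curve is the range of a continuous function $g$ from an interval $I$ of positive length to $\mathbb{R}^n$ ($n\ge 2$). It is simple if $x_1\neq x_2$ implies $g(x_1)\ne g(x_2)$ except possibly for the endpoints of $I$. A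 simple closed curve is the range of such a $g$ with $I=[a,b]$, $g(a)=g(b)$ and $g$ injective on $[a,b)$ (equivalently, a homeomorphic image of a circle of nonzero radius). A curve is rectifiable if the lengths of its inscribed polygons form a bounded subset of $\mathbb{R}$. *)

(* Defs.v *)
From HB Require Import structures.
From mathcomp Require Import all_boot all_order all_algebra.
From mathcomp Require Import all_classical all_reals all_analysis.

Set Implicit Arguments.
Unset Strict Implicit.
Unset Printing Implicit Defensive.

Import Order.TTheory GRing.Theory Num.Theory.
Import numFieldNormedType.Exports.

Local Open Scope classical_set_scope.
Local Open Scope ring_scope.

Definition boundary (T : topologicalType) (A : set T) : set T :=
  closure A `\` interior A.

(* The library norm on ['rV[R]_n] is the sup norm. It induces the Euclidean
   topology, used below for compactness, boundary and continuity, but lengths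
   have to be measured with the Euclidean norm. *)
Definition enorm (R : realType) (n : nat) (v : 'rV[R]_n) : R :=
  Num.sqrt (\sum_(i < n) v 0 i ^+ 2).

Section directed_lines.
Context {R : realType}.

Definition unit_circle : set 'rV[R]_2 :=
  [set v | v 0 0 ^+ 2 + v 0 1 ^+ 2 = 1].

(* The base point serves only to describe the line: moving it along the line
   gives another representation of the same directed line, and nothing below
   depends on the choice. *)
Record directed_line := DirectedLine {
  base : 'rV[R]_2;
  dir : 'rV[R]_2;
  dir_unit : unit_circle dir }.

Definition line (l : directed_line) : set 'rV[R]_2 :=
  [set q | exists t : R, q = base l + t *: dir l].

(* [q] lies to the left of [l], or on [l], when the determinant with rows
   [dir l] and [q - base l] is nonnegative. *)
Definition left_halfplane (l : directed_line) : set 'rV[R]_2 :=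
  [set q | 0 <= dir l 0 0 * (q - base l) 0 1 - dir l 0 1 * (q - base l) 0 0].

Definition supporting_line (H : set 'rV[R]_2) (l : directed_line) : Prop :=
  H `<=` left_halfplane l /\ line l `&` H !=set0.

Definition pointed_supporting_line (H : set 'rV[R]_2) (P : 'rV[R]_2)
    (l : directed_line) : Prop :=
  [/\ boundary H P, supporting_line H l & line l P].

Definition Sli (H : set 'rV[R]_2) : set 'rV[R]_(2 + 2) :=
  [set x | exists P l,
    pointed_supporting_line H P l /\ x = row_mx P (dir l)].

End directed_lines.

Section curves.
Context {R : realType} {n : nat}.
Implicit Types (a b : R) (g : R -> 'rV[R]_n) (C : set 'rV[R]_n).

Definition simple_closed_param a b g C : Prop :=
  [/\ a < b, {within `[a, b], continuous g}, g a = g b,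
      {in `[a, b[ &, injective g} & g @` `[a, b] = C].

(* For [itv_partition a b s], the inscribed polygon has the successive vertices
   [g t] for [t] in [a :: s], whose last element is [b]. *)
Definition polygon_length a b g (s : seq R) : R :=
  let V := g \o nth b (a :: s) in
  \sum_(0 <= i < size s) enorm (V i.+1 - V i).

Definition rectifiable_param a b g : Prop :=
  bounded_set [set polygon_length a b g s | s in itv_partition a b].

(* The length of a simple closed curve does not depend on the choice of its
   injective parametrization, so that it is enough to bound the inscribed
   polygons of one of them. *)
Definition rectifiable_simple_closed_curve C : Prop :=
  exists a b g, simple_closed_param a b g C /\ rectifiable_param a b g.

End curves.

(* Main.v *)
Require Import Defs.
From HB Require Import structures.
From mathcomp Require Import all_boot all_order all_algebra.
From mathcomp Require Import all_classical all_reals all_analysis.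
From mathcomp Require Import ring lra.

Set Implicit Arguments.
Unset Strict Implicit.
Unset Printing Implicit Defensive.

Import Order.TTheory GRing.Theory Num.Theory.
Import numFieldNormedType.Exports.

Local Open Scope classical_set_scope.
Local Open Scope ring_scope.

(** Push every pointed supporting line [(P, l)] of [H] to the point [Q = P + n],
    where [n] is the outer unit normal of [l], that is, the unit vector which a
    quarter turn takes to the direction of [l].  That [l] supports [H] at [P]
    means that [n] makes a nonpositive inner product with [h - P] for every [h]
    in [H], and this is exactly the variational characterization of [P] as the
    point of [H] nearest to [Q].  So [Sli H] is the image of the level set
    [dist_to H Q = 1] under the map [slide H], which sends [Q] to its nearest
    point [P] and to the quarter turn of [Q - P] (lemma [Sli_slide]).  The map
    [slide H] is injective, because [Q] is the sum of [P] and [Q - P], and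
    Lipschitz, because the nearest point map of a convex set is nonexpansive
    ([nearest_point_nonexpansive]).

    The passage to distance one removes all degeneracies: corners, edges, and
    the cases where [H] is a segment or a point.  Seen from a point [c] of [H],
    the level set is a radial graph over the unit circle.  Along a ray from
    [c], the distance to [H] starts at 0, is convex, and tends to infinity,
    so it takes the value 1 exactly once.  Comparing two rays by convexity
    shows that the radius at which this happens is a Lipschitz function of the
    direction ([dist_ray_lipschitz], [radial_lipschitz]).

    The composition of the angular parametrization of the unit circle on
    [[0, 2 pi]], of this radial graph and of [slide H] is therefore a Lipschitz
    parametrization of [Sli H] that is injective up to its endpoints; a
    Lipschitz curve on a bounded interval is continuous and rectifiable. *)

(** * Euclidean inner product and norm *)

Definition dotp (R : realType) n (u v : 'rV[R]_n) : R := \sum_i u 0 i * v 0 i.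

Lemma dotpC (R : realType) n (u v : 'rV[R]_n) : dotp u v = dotp v u.
Proof. by apply: eq_bigr => i _; rewrite mulrC. Qed.

Lemma dotpDl (R : realType) n (u v w : 'rV[R]_n) :
  dotp (u + v) w = dotp u w + dotp v w.
Proof. by rewrite -big_split; apply: eq_bigr => i _; rewrite mxE mulrDl. Qed.

Lemma dotpZl (R : realType) n (k : R) (u w : 'rV[R]_n) :
  dotp (k *: u) w = k * dotp u w.
Proof. by rewrite mulr_sumr; apply: eq_bigr => i _; rewrite mxE mulrA. Qed.

Lemma dotpNl (R : realType) n (u w : 'rV[R]_n) : dotp (- u) w = - dotp u w.
Proof. by rewrite -scaleN1r dotpZl mulN1r. Qed.

Lemma dotp0l (R : realType) n (w : 'rV[R]_n) : dotp 0 w = 0.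
Proof. by rewrite -(scale0r w) dotpZl mul0r. Qed.

Lemma dotp0r (R : realType) n (w : 'rV[R]_n) : dotp w 0 = 0.
Proof. by rewrite dotpC dotp0l. Qed.

Lemma dotpDr (R : realType) n (u v w : 'rV[R]_n) :
  dotp w (u + v) = dotp w u + dotp w v.
Proof. by rewrite !(dotpC w) dotpDl. Qed.

Lemma dotpZr (R : realType) n (k : R) (u w : 'rV[R]_n) :
  dotp w (k *: u) = k * dotp w u.
Proof. by rewrite !(dotpC w) dotpZl. Qed.

Lemma dotpNr (R : realType) n (u w : 'rV[R]_n) : dotp w (- u) = - dotp w u.
Proof. by rewrite !(dotpC w) dotpNl. Qed.

Definition dotpE := (dotpDl, dotpDr, dotpNl, dotpNr, dotpZl, dotpZr).

Lemma enorm_ge0 (R : realType) n (v : 'rV[R]_n) : 0 <= enorm v.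
Proof. exact: sqrtr_ge0. Qed.

Lemma enorm_sqr (R : realType) n (v : 'rV[R]_n) : enorm v ^+ 2 = dotp v v.
Proof. by rewrite sqr_sqrtr //; apply: sumr_ge0 => i _; rewrite sqr_ge0. Qed.

Lemma enormP (R : realType) n (v : 'rV[R]_n) (k : R) :
  0 <= k -> dotp v v = k ^+ 2 -> enorm v = k.
Proof.
by move=> k0 vk; apply/eqP; rewrite -(@eqrXn2 _ 2) ?enorm_ge0// enorm_sqr vk.
Qed.

Lemma enorm_le (R : realType) n (v : 'rV[R]_n) (k : R) :
  0 <= k -> dotp v v <= k ^+ 2 -> enorm v <= k.
Proof.
by move=> k0; rewrite -enorm_sqr ler_sqr ?nnegrE ?enorm_ge0.
Qed.

Lemma enorm0 (R : realType) n : enorm (0 : 'rV[R]_n) = 0.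
Proof. by apply: enormP => //; rewrite dotp0l expr0n. Qed.

Lemma enorm_eq0 (R : realType) n (v : 'rV[R]_n) : enorm v = 0 -> v = 0.
Proof.
move=> v0; apply/rowP => i; rewrite mxE.
have : \sum_j v 0 j ^+ 2 = 0.
  by rewrite -[RHS](expr0n R 2) -[in RHS]v0 enorm_sqr.
move/eqP; rewrite psumr_eq0 => [/allP /(_ i)|j _]; last exact: sqr_ge0.
by rewrite mem_index_enum sqrf_eq0 => /(_ isT) /eqP.
Qed.

Lemma enormN (R : realType) n (v : 'rV[R]_n) : enorm (- v) = enorm v.
Proof. by apply: enormP; rewrite ?enorm_ge0// enorm_sqr !dotpE opprK. Qed.

Lemma enormZ (R : realType) n (k : R) (v : 'rV[R]_n) :
  enorm (k *: v) = `|k| * enorm v.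
Proof.
apply: enormP; first by rewrite mulr_ge0 ?enorm_ge0.
by rewrite exprMn real_normK ?num_real// enorm_sqr !dotpE; ring.
Qed.

Lemma dotp_le_enorm (R : realType) n (u v : 'rV[R]_n) :
  dotp u v <= enorm u * enorm v.
Proof.
have [u0|u0] := eqVneq (enorm u) 0.
  by rewrite (enorm_eq0 u0) dotp0l mulr_ge0 ?enorm_ge0.
have [v0|v0] := eqVneq (enorm v) 0.
  by rewrite (enorm_eq0 v0) dotp0r mulr_ge0 ?enorm_ge0.
have {}u0 : 0 < enorm u by rewrite lt0r u0 enorm_ge0.
have {}v0 : 0 < enorm v by rewrite lt0r v0 enorm_ge0.
have := sqr_ge0 (enorm (enorm v *: u - enorm u *: v)).
rewrite enorm_sqr !dotpE -!enorm_sqr (dotpC v u).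
set a := enorm u in u0 *; set b := enorm v in v0 *; set c := dotp u v => h.
have : 0 <= (a * b) * (a * b - c) by nra.
by rewrite pmulr_rge0 ?mulr_gt0// subr_ge0.
Qed.

Lemma enormD (R : realType) n (u v : 'rV[R]_n) :
  enorm (u + v) <= enorm u + enorm v.
Proof.
apply: enorm_le; first by rewrite addr_ge0 ?enorm_ge0.
have := dotp_le_enorm u v.
by rewrite !dotpE sqrrD !enorm_sqr (dotpC v u); lra.
Qed.

Lemma enormB (R : realType) n (u v : 'rV[R]_n) :
  enorm (u - v) = enorm (v - u).
Proof. by rewrite -enormN opprB. Qed.

Lemma enorm_triangle (R : realType) n (v u w : 'rV[R]_n) :
  enorm (u - w) <= enorm (u - v) + enorm (v - w).
Proof. by rewrite -[u - w](subrKA v) enormD. Qed.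

(** This turns Euclidean Lipschitz bounds into continuity for the topology of
    the sup norm, and Euclidean segments into paths inside sup norm balls. *)
Lemma norm_le_enorm (R : realType) n (v : 'rV[R]_n) : `|v| <= enorm v.
Proof.
rewrite /Num.norm/= mx_normrE; apply: bigmax_le => [|[i j] _ /=].
  exact: enorm_ge0.
rewrite ord1 -sqrtr_sqr ler_wsqrtr// (bigD1 j)//= lerDl.
by apply: sumr_ge0 => k _; rewrite sqr_ge0.
Qed.

Lemma continuous_enorm_sub (R : realType) n (u : 'rV[R]_n) :
  continuous (fun v : 'rV[R]_n => enorm (u - v)).
Proof.
move=> v; apply: (@continuous_comp _ _ _
  (fun v : 'rV[R]_n => \sum_i (u - v) 0 i ^+ 2) Num.sqrt); last first.
  exact: sqrt_continuous.
move: v; apply: continuous_big => [|i _ v]; first exact: add_continuous.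
apply: (@continuous_comp _ _ _ (fun v : 'rV[R]_n => (u - v) 0 i)
  (fun x => x ^+ 2)); last exact: exprn_continuous.
apply: (@continuous_comp _ _ _ (fun v : 'rV[R]_n => u - v)
  (fun x : 'rV[R]_n => x 0 i)); last exact: coord_continuous.
exact: (continuousB (@cst_continuous _ _ _ _)).
Qed.

(** * Lipschitz maps and rectifiability *)

Lemma lipschitz_continuous (R : realType) (V W : normedModType R)
    (f : V -> W) (k : R) :
  (forall x y, `|f x - f y| <= k * `|x - y|) -> continuous f.
Proof.
move=> fk x; apply/cvgrPdist_le => e e0.
have k0 : 0 < `|k| + 1 by rewrite ltr_wpDl.
near=> y.
apply: (le_trans (fk x y)); apply: (@le_trans _ _ ((`|k| + 1) * `|x - y|)).
  by rewrite ler_wpM2r// (le_trans (ler_norm k))// lerDl.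
rewrite mulrC -ler_pdivlMr//; near: y.
by apply: cvgr_dist_le; [exact: cvg_id|rewrite divr_gt0].
Unshelve. all: by end_near. Qed.

(** Each edge of the inscribed polygon is at most [k] times the length of its
    parameter interval, and these lengths telescope to [b - a]. *)
Lemma polygon_length_le (R : realType) n (a b k : R) (g : R -> 'rV[R]_n) s :
  0 <= k -> (forall x y, enorm (g x - g y) <= k * `|x - y|) ->
  itv_partition a b s -> polygon_length a b g s <= k * (b - a).
Proof.
move=> k0 gk abs; have [pas _] := abs.
set x := nth b (a :: s).
have -> : b - a = \sum_(0 <= i < size s) (x i.+1 - x i).
  by rewrite telescope_sumr// /x /= (itv_partition_nth_size _ abs).
rewrite mulr_sumr /polygon_length; apply: ler_sum_nat => i /andP[_ si].
rewrite (le_trans (gk _ _))// ler_wpM2l// ger0_norm// subr_ge0 ltW//.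
by move/(pathP b): pas; apply.
Qed.

Lemma lipschitz_rectifiable (R : realType) n (a b k : R)
    (g : R -> 'rV[R]_n) :
  0 <= k -> (forall x y, enorm (g x - g y) <= k * `|x - y|) ->
  rectifiable_param a b g.
Proof.
move=> k0 gk; exists (k * (b - a)); split; first exact: num_real.
move=> M bM _ [s abs <-] /=.
rewrite ger0_norm; last by apply: sumr_ge0 => i _; exact: enorm_ge0.
by rewrite (le_trans (polygon_length_le k0 gk abs))// ltW.
Qed.

(** * Nearest points of convex sets *)

Lemma convex_set_segment (R : realType) n (H : set 'rV[R]_n) x y t :
  convex_set H -> H x -> H y -> 0 <= t <= 1 -> H (x + t *: (y - x)).
Proof.
move=> cH Hx Hy /andP[t0 t1].
have := cH y x (Itv01 t0 t1); rewrite !inE => /(_ Hy Hx).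
have <- // : t *: y + (1 - t) *: x = x + t *: (y - x).
by rewrite scalerBr scalerBl scale1r addrCA.
Qed.

(** For convex [H], the variational inequality says that [P] minimizes the
    distance to [Q] over [H].  Read with [Q - P] as a normal vector, it says
    that the hyperplane through [P] orthogonal to [Q - P] supports [H]. *)
Definition nearest_point (R : realType) n (H : set 'rV[R]_n)
    (Q P : 'rV[R]_n) : Prop :=
  H P /\ forall h, H h -> dotp (Q - P) (h - P) <= 0.

Lemma dotp_subZ (R : realType) n (w d : 'rV[R]_n) (t : R) :
  dotp (w - t *: d) (w - t *: d) =
  dotp w w - 2 * t * dotp w d + t * t * dotp d d.
Proof. by rewrite !dotpE (dotpC d w); ring. Qed.

(** A minimizer [P] of the distance to [Q] works: if [c := dotp (Q - P) (h - P)]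
    were positive, then moving from [P] a little towards [h] would bring the
    point closer to [Q]. *)
Lemma nearest_point_exists (R : realType) n (H : set 'rV[R]_n) Q :
  H !=set0 -> compact H -> convex_set H -> exists P, nearest_point H Q P.
Proof.
move=> H0 cH vH.
have [|P] := @compact_EVT_min _ _ (fun v : 'rV[R]_n => enorm (Q - v)) H H0 cH.
  by apply: continuous_subspaceT; exact: continuous_enorm_sub.
rewrite inE => HP Pmin; exists P; split=> // h Hh.
set c := dotp _ _; set d := h - P; rewrite leNgt; apply/negP => c0.
(* Expand the minimality of [P] against the point [P + t *: d] of [H] and
   divide by [t]. *)
have small t : 0 < t <= 1 -> 2 * c <= t * dotp d d.
  move=> /andP[t0 t1].
  have Hx : P + t *: d \in H.
    by rewrite inE; apply: convex_set_segment => //; rewrite t1 ltW.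
  have := Pmin _ Hx.
  rewrite -ler_sqr ?nnegrE ?enorm_ge0// !enorm_sqr opprD addrA.
  rewrite dotp_subZ -/c => h1.
  have : 0 <= t * (t * dotp d d - 2 * c) by lra.
  by rewrite pmulr_rge0// subr_ge0.
(* The best step [t = c / dotp d d] gives [2 * c <= c]; it is truncated at
   [t = 1] when it would overshoot [h]. *)
have [dc|cd] := leP (dotp d d) c.
  by have := small 1; rewrite ltr01 lexx => /(_ isT); lra.
have d0 : 0 < dotp d d by apply: lt_trans cd.
have := small (c / dotp d d).
rewrite divr_gt0// ler_pdivrMr// mul1r ltW// divfK ?gt_eqF// => /(_ isT).
by lra.
Qed.

(** Add the two variational inequalities, each tested at the other nearest
    point, and apply the Cauchy-Schwarz inequality. *)
Lemma nearest_point_nonexpansive (R : realType) n (H : set 'rV[R]_n)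
    Q Q' P P' :
  nearest_point H Q P -> nearest_point H Q' P' ->
  enorm (P - P') <= enorm (Q - Q').
Proof.
move=> [HP nP] [HP' nP'].
have h : enorm (P - P') ^+ 2 <= dotp (Q - Q') (P - P').
  have := nP _ HP'; have := nP' _ HP; rewrite enorm_sqr !dotpE.
  by rewrite (dotpC P' P); lra.
have := enorm_ge0 (P - P'); rewrite le_eqVlt => /predU1P[<-|P0].
  exact: enorm_ge0.
rewrite -(ler_pM2r P0) -expr2 (le_trans h)//; exact: dotp_le_enorm.
Qed.

Lemma nearest_point_unique (R : realType) n (H : set 'rV[R]_n) Q P P' :
  nearest_point H Q P -> nearest_point H Q P' -> P = P'.
Proof.
move=> nP nP'; apply/eqP; rewrite -subr_eq0; apply/eqP/enorm_eq0.
apply/le_anti; rewrite enorm_ge0 andbT.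
by rewrite (le_trans (nearest_point_nonexpansive nP nP'))// subrr enorm0.
Qed.

Lemma nearest_point_le (R : realType) n (H : set 'rV[R]_n) Q P h :
  nearest_point H Q P -> H h -> enorm (Q - P) <= enorm (Q - h).
Proof.
move=> [HP nP] Hh; apply: enorm_le; first exact: enorm_ge0.
rewrite enorm_sqr; have := nP _ Hh.
have -> : Q - h = (Q - P) - (h - P) by rewrite opprB addrA subrK.
move: (Q - P) (h - P) => u v.
have := sqr_ge0 (enorm v); rewrite enorm_sqr !dotpE (dotpC v u).
by lra.
Qed.

(** * The distance to a convex set along rays *)

HB.lock Definition nearest (R : realType) n (H : set 'rV[R]_n)
    (Q : 'rV[R]_n) : 'rV[R]_n :=
  xget 0 (nearest_point H Q).

HB.lock Definition dist_to (R : realType) n (H : set 'rV[R]_n)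
    (Q : 'rV[R]_n) : R :=
  enorm (Q - nearest H Q).

Lemma nearestP (R : realType) n (H : set 'rV[R]_n) :
  H !=set0 -> compact H -> convex_set H ->
  forall Q, nearest_point H Q (nearest H Q).
Proof.
move=> H0 cH vH Q; rewrite nearest.unlock; apply: xgetPex.
exact: nearest_point_exists.
Qed.

HB.lock Definition radius (R : realType) n (H : set 'rV[R]_n) c e : R :=
  xget 0 [set t | 0 <= t /\ dist_to H (c + t *: e) = 1].

Lemma lipschitz_reaches1 (R : realType) (f : R -> R) M :
  0 <= M -> (forall a b, f a <= f b + `|a - b|) -> f 0 <= 0 -> 1 <= f M ->
  exists2 t, 0 <= t & f t = 1.
Proof.
move=> M0 fL f0 fM.
have f_cont : continuous f.
  apply: (@lipschitz_continuous R R R f 1) => x y.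
  have := fL x y; have := fL y x; rewrite (distrC y x) mul1r ler_norml.
  by move: (f x) (f y) => a b; lra.
have [||t] := @IVT R f 0 M 1 M0.
- exact: continuous_subspaceT.
- by rewrite ge_min le_max fM orbT (le_trans f0).
by rewrite in_itv/= => /andP[t0 _] ft; exists t.
Qed.

Lemma scale_unit_inj (R : realType) n (r r' : R) (e e' : 'rV[R]_n) :
  0 < r -> 0 < r' -> enorm e = 1 -> enorm e' = 1 ->
  r *: e = r' *: e' -> e = e'.
Proof.
move=> r0 r'0 e1 e'1 ee'.
have rr' : r = r'.
  have := congr1 (@enorm R n) ee'.
  by rewrite !enormZ e1 e'1 !mulr1 !gtr0_norm.
by move: ee'; rewrite rr'; apply: scalerI; rewrite gt_eqF.
Qed.

Section distance_to_convex_set.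
Context {R : realType} {n : nat} (H : set 'rV[R]_n).
Context (H0 : H !=set0) (cH : compact H) (vH : convex_set H).

Let nP := nearestP H0 cH vH.

Lemma nearest_eq Q P : nearest_point H Q P -> nearest H Q = P.
Proof. by move/nearest_point_unique => /(_ _ (nP Q)). Qed.

Lemma dist_le Q h : H h -> dist_to H Q <= enorm (Q - h).
Proof. by rewrite dist_to.unlock; exact: nearest_point_le. Qed.

Lemma dist_ge_sub Q c B :
  (forall h, H h -> enorm (c - h) <= B) -> enorm (Q - c) - B <= dist_to H Q.
Proof.
move=> HB; have [/HB cB _] := nP Q.
have := enorm_triangle (nearest H Q) Q c; rewrite dist_to.unlock.
rewrite (enormB (nearest H Q)).
by lra.
Qed.

Lemma dist_lipschitz Q Q' : dist_to H Q <= dist_to H Q' + enorm (Q - Q').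
Proof.
have [/dist_le-/(_ Q) h _] := nP Q'; apply: (le_trans h).
by rewrite [in leRHS]dist_to.unlock [leRHS]addrC; exact: enorm_triangle.
Qed.

(** The instance, for a center [c] in [H], of the convexity of the distance:
    the homothetic image of the nearest point stays in [H]. *)
Lemma dist_homothety c v s : H c -> 0 <= s <= 1 ->
  dist_to H (c + s *: v) <= s * dist_to H (c + v).
Proof.
move=> Hc s01; have [HP _] := nP (c + v).
have := dist_le (c + s *: v) (convex_set_segment vH Hc HP s01).
rewrite opprD addrACA subrr add0r -scalerBr enormZ ger0_norm; last by lra.
by rewrite opprB addrA (addrC v) => h; rewrite [in leRHS]dist_to.unlock.
Qed.

(** For [t' < t], convexity along the ray of direction [e'] makes the distance
    at [t] at least [t / t'], while at [t] on the ray of direction [e] it is 1,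
    and the two points are [t * enorm (e - e')] apart.  With [e = e'] this
    gives the uniqueness of the point at distance 1 on a ray. *)
Lemma dist_ray_lipschitz c e e' t t' : H c -> 0 <= t -> 0 <= t' ->
  dist_to H (c + t *: e) = 1 -> dist_to H (c + t' *: e') = 1 ->
  t - t' <= t * t' * enorm (e - e').
Proof.
move=> Hc t0 t'0 et et'.
have tt' : 0 <= t * t' * enorm (e - e') by rewrite !mulr_ge0 ?enorm_ge0.
have [tt|t't] := leP t t'; first by rewrite (le_trans _ tt')// subr_le0.
have {}t0 : 0 < t := le_lt_trans t'0 t't.
have s01 : 0 <= t' / t <= 1.
  by rewrite divr_ge0 ?(ltW t0)//= ler_pdivrMr// mul1r ltW.
have := dist_homothety (t *: e') Hc s01.
rewrite scalerA divfK ?gt_eqF// et' mulrAC ler_pdivlMr// mul1r.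
have -> : t - t' = t - t' * 1 by rewrite mulr1.
rewrite lerBlDl (mulrC t) -mulrA -mulrDr => /le_trans; apply.
apply: (ler_wpM2l t'0).
have := dist_lipschitz (c + t *: e') (c + t *: e).
rewrite et opprD addrACA subrr add0r -scalerBr enormZ (gtr0_norm t0).
by rewrite (enormB e').
Qed.

Lemma bounded_from c : exists2 B, 0 <= B & forall h, H h -> enorm (c - h) <= B.
Proof.
have [|C _ HC] :=
    @compact_EVT_max _ _ (fun v : 'rV[R]_n => enorm (c - v)) H H0 cH.
  by apply: continuous_subspaceT; exact: continuous_enorm_sub.
exists (enorm (c - C)); first exact: enorm_ge0.
by move=> h Hh; apply: HC; rewrite inE.
Qed.

(** The distance vanishes at [c], and at [c + t *: e] it is at least [t - B],
    where [B] bounds the distances from [c] to the points of [H]. *)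
Lemma dist_ray_eq1 c e : H c -> enorm e = 1 ->
  exists2 t, 0 <= t & dist_to H (c + t *: e) = 1.
Proof.
move=> Hc e1.
have [B B0 HB] := bounded_from c.
apply: (@lipschitz_reaches1 _ (fun t => dist_to H (c + t *: e)) (B + 1)).
- by rewrite addr_ge0.
- move=> a b /=; have := dist_lipschitz (c + a *: e) (c + b *: e).
  by rewrite opprD addrACA subrr add0r -scalerBl enormZ e1 mulr1.
- by rewrite scale0r addr0 (le_trans (dist_le c Hc))// subrr enorm0.
have := dist_ge_sub (c + (B + 1) *: e) HB.
rewrite (addrC c) addrK enormZ e1 ger0_norm ?addr_ge0// mulr1.
by rewrite addrAC subrr add0r.
Qed.

Definition radial c e : 'rV[R]_n := c + radius H c e *: e.

Lemma radiusP c e : H c -> enorm e = 1 ->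
  0 <= radius H c e /\ dist_to H (radial c e) = 1.
Proof.
move=> Hc /(dist_ray_eq1 Hc)[t t0 et].
rewrite /radial radius.unlock.
apply: (@xgetPex _ 0 [set t | 0 <= t /\ dist_to H (c + t *: e) = 1]).
by exists t.
Qed.

(** The distance to [H] at [c + t *: e] is at most [t], as [c] lies in [H]. *)
Lemma radius_ge1 c e : H c -> enorm e = 1 -> 1 <= radius H c e.
Proof.
move=> Hc e1; have [r0 <-] := radiusP Hc e1.
rewrite (le_trans (dist_le _ Hc))// /radial (addrC c) addrK enormZ e1 mulr1.
by rewrite ger0_norm.
Qed.

(** With [e] the direction from [c] to [Q], the radius and the length of [Q - c]
    both give points of that ray at distance 1 from [H], so they agree. *)
Lemma radial_surj c Q : H c -> dist_to H Q = 1 ->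
  exists2 e, enorm e = 1 & radial c e = Q.
Proof.
move=> Hc Q1.
have q1 : 1 <= enorm (Q - c) by rewrite -Q1 dist_le.
have q0 : enorm (Q - c) != 0 by rewrite gt_eqF// (lt_le_trans ltr01).
have [e e1 Qe] : exists2 e, enorm e = 1 & Q = c + enorm (Q - c) *: e.
  exists ((enorm (Q - c))^-1 *: (Q - c)).
    by rewrite enormZ normfV (ger0_norm (enorm_ge0 _)) mulVf.
  by rewrite scalerA divff// scale1r addrC subrK.
exists e => //; have [r0 re] := radiusP Hc e1.
move: Q1; rewrite /radial Qe.
move: (enorm (Q - c)) (enorm_ge0 (Q - c)) => q q_ge0 qe.
have := dist_ray_lipschitz Hc r0 q_ge0 re qe.
have := dist_ray_lipschitz Hc q_ge0 r0 qe re.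
rewrite subrr enorm0 !mulr0 !subr_le0 => qr rq.
by congr (_ + _ *: _); apply/le_anti; rewrite rq qr.
Qed.

Lemma radial_inj c e e' : H c -> enorm e = 1 -> enorm e' = 1 ->
  radial c e = radial c e' -> e = e'.
Proof.
move=> Hc e1 e'1 /addrI.
have := radius_ge1 Hc e1; have := radius_ge1 Hc e'1.
move=> /(lt_le_trans ltr01) r'0 /(lt_le_trans ltr01) r0.
exact: scale_unit_inj.
Qed.

(** Here [B + 1] bounds the radius, so the radius has Lipschitz constant
    [(B + 1) ^+ 2] by [dist_ray_lipschitz]; the second term of the constant
    comes from the variation of the direction at fixed radius. *)
Lemma radial_lipschitz c : H c -> exists2 k, 0 <= k &
  forall e e', enorm e = 1 -> enorm e' = 1 ->
  enorm (radial c e - radial c e') <= k * enorm (e - e').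
Proof.
move=> Hc; have [B B0 HB] := bounded_from c.
have rB e : enorm e = 1 -> radius H c e <= B + 1.
  move=> e1; have [r0 re] := radiusP Hc e1.
  have := dist_ge_sub (radial c e) HB; rewrite re.
  by rewrite /radial (addrC c) addrK enormZ e1 (ger0_norm r0) mulr1 lerBlDl.
exists ((B + 1) ^+ 2 + (B + 1)) => [|e e' e1 e'1].
  by rewrite addr_ge0 ?sqr_ge0 ?addr_ge0.
have [r0 re] := radiusP Hc e1; have [r'0 re'] := radiusP Hc e'1.
have Lr : `|radius H c e - radius H c e'| <= (B + 1) ^+ 2 * enorm (e - e').
  have rr : radius H c e * radius H c e' * enorm (e - e') <=
      (B + 1) ^+ 2 * enorm (e - e').
    by rewrite ler_wpM2r ?enorm_ge0// expr2 ler_pM ?rB.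
  have := dist_ray_lipschitz Hc r0 r'0 re re'.
  have := dist_ray_lipschitz Hc r'0 r0 re' re.
  rewrite (enormB e') (mulrC (radius H c e')) => h1 h2.
  by rewrite ler_norml lerNl opprB (le_trans h1 rr) (le_trans h2 rr).
have -> : radial c e - radial c e' =
    (radius H c e - radius H c e') *: e + radius H c e' *: (e - e').
  by rewrite opprD addrACA subrr add0r scalerBl scalerBr addrA subrK.
rewrite (le_trans (enormD _ _))// !enormZ e1 mulr1 mulrDl lerD//.
by rewrite ger0_norm// ler_wpM2r ?enorm_ge0 ?rB.
Qed.

End distance_to_convex_set.

(** * The quarter turn and the unit circle *)

Definition row2 (R : realType) (x y : R) : 'rV[R]_2 :=
  \row_j (if j == 0 then x else y).

Lemma row2P (R : realType) (u v : 'rV[R]_2) :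
  u 0 0 = v 0 0 -> u 0 1 = v 0 1 -> u = v.
Proof.
move=> uv0 uv1; apply/rowP => i; case: (unliftP 0 i) => [j ->|->//].
by rewrite (ord1 j) (_ : lift 0 0 = 1)//; apply/val_inj.
Qed.

Lemma dotp2E (R : realType) (u v : 'rV[R]_2) :
  dotp u v = u 0 0 * v 0 0 + u 0 1 * v 0 1.
Proof.
rewrite /dotp big_ord_recl big_ord1 (_ : lift _ _ = 1)//; exact/val_inj.
Qed.

Definition rot (R : realType) (v : 'rV[R]_2) : 'rV[R]_2 :=
  row2 (- v 0 1) (v 0 0).

Lemma rotB (R : realType) (u v : 'rV[R]_2) : rot (u - v) = rot u - rot v.
Proof. by apply: row2P; rewrite !mxE//= opprD. Qed.

Lemma enorm_rot (R : realType) (v : 'rV[R]_2) : enorm (rot v) = enorm v.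
Proof.
apply: enormP; first exact: enorm_ge0.
by rewrite enorm_sqr !dotp2E !mxE /=; ring.
Qed.

Lemma rot_inj (R : realType) : injective (@rot R).
Proof.
move=> u v uv; apply: row2P.
  by have := congr1 (fun w : 'rV[R]_2 => w 0 1) uv; rewrite !mxE.
have := congr1 (fun w : 'rV[R]_2 => w 0 0) uv; rewrite !mxE /=.
exact: oppr_inj.
Qed.

Definition circle (R : realType) (t : R) : 'rV[R]_2 := row2 (cos t) (sin t).

Lemma enorm_circle (R : realType) (t : R) : enorm (circle t) = 1.
Proof.
by apply: enormP => //; rewrite dotp2E !mxE /= -!expr2 cos2Dsin2 expr1n.
Qed.

Lemma circle_2pi (R : realType) : circle 0 = circle (pi *+ 2) :> 'rV[R]_2.
Proof.
by rewrite /circle cos2pi -(add0r (pi *+ 2)) sinD2pi cos0 sin0.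
Qed.

Lemma norm_sin_le (R : realType) (x : R) : 0 <= x -> `|sin x| <= x.
Proof.
rewrite le_eqVlt => /predU1P[<-|x0]; first by rewrite sin0 normr0.
have [|c _] := @MVT R sin cos 0 x x0 (fun x _ => is_derive_sin x).
  by apply: continuous_subspaceT => y; exact: continuous_sin.
rewrite sin0 !subr0 => ->; rewrite normrM (gtr0_norm x0).
by rewrite ler_piMl ?cos_max// ltW.
Qed.

(** Everything about the parametrization of the circle is read off from the
    length of a chord: it is at most the length of the arc, and it vanishes on
    [[0, 2 pi[] only for equal endpoints. *)
Lemma circle_chord (R : realType) (s t : R) :
  enorm (circle s - circle t) ^+ 2 = (2 * sin ((s - t) / 2)) ^+ 2.
Proof.
have -> : (2 * sin ((s - t) / 2)) ^+ 2 = 2 - 2 * cos (s - t).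
  rewrite [in RHS](splitr (s - t)) cosD -!expr2 cos2sin2; ring.
rewrite enorm_sqr dotp2E !mxE /= cosB.
have := cos2Dsin2 s; have := cos2Dsin2 t; rewrite !expr2; lra.
Qed.

Lemma circle_lipschitz (R : realType) (s t : R) :
  enorm (circle s - circle t) <= `|s - t|.
Proof.
wlog st : s t / t <= s => [h|].
  by have [/h//|/ltW/h] := leP t s; rewrite enormB distrC.
rewrite -ler_sqr ?nnegrE ?enorm_ge0// circle_chord.
rewrite -(real_normK (num_real (2 * _))) ler_sqr ?nnegrE//.
rewrite normrM ger0_norm// mulrC -ler_pdivlMr//.
rewrite (ger0_norm (_ : 0 <= s - t)) ?subr_ge0// norm_sin_le//.
by rewrite divr_ge0// subr_ge0.
Qed.

Lemma circle_inj (R : realType) :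
  {in `[0, pi *+ 2[ &, injective (@circle R)}.
Proof.
move=> s t; rewrite !in_itv/= => /andP[s0 s2] /andP[t0 t2].
wlog st : s t s0 s2 t0 t2 / t <= s => [h|] E.
  have [ts|/ltW st] := leP t s; first exact: h.
  by apply/esym/h.
have := circle_chord s t; rewrite E subrr enorm_sqr dotp0l => /esym/eqP.
rewrite sqrf_eq0 mulf_eq0 pnatr_eq0/= => /eqP sin0.
apply/eqP; rewrite -subr_eq0 eq_le subr_ge0 st andbT leNgt; apply/negP => d0.
have : 0 < sin ((s - t) / 2).
  by apply: sin_gt0_pi; move: s2; rewrite mulr2n => s2; apply/andP; split; lra.
by rewrite sin0 ltxx.
Qed.

Lemma circle_surj (R : realType) (e : 'rV[R]_2) : enorm e = 1 ->
  exists2 t, t \in `[0, pi *+ 2[ & circle t = e.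
Proof.
move=> e1; have : e 0 0 ^+ 2 + e 0 1 ^+ 2 = 1.
  by rewrite !expr2 -dotp2E -enorm_sqr e1 expr1n.
set x := e 0 0; set y := e 0 1 => xy.
have x1 : -1 <= x <= 1.
  rewrite -ler_norml -ler_sqr ?nnegrE// real_normK ?num_real// expr1n.
  by rewrite -xy lerDl sqr_ge0.
have sx : sin (acos x) = `|y|.
  by rewrite sin_acos// -xy addrAC subrr add0r sqrtr_sqr.
have pi0 := pi_gt0 R.
have a0 := acos_ge0 x1; have api := acos_lepi x1.
have [y0|y0] := leP 0 y.
  exists (acos x); first by rewrite in_itv/= a0 mulr2n; lra.
  by apply: row2P; rewrite !mxE /= ?acosK// sx ger0_norm.
have ap : 0 < acos x.
  rewrite lt_neqAle a0 andbT eq_sym; apply/eqP => a00.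
  by move: sx; rewrite a00 sin0 => /esym/normr0P; rewrite lt_eqF.
exists (pi *+ 2 - acos x).
  by rewrite in_itv/= mulr2n; apply/andP; split; lra.
apply: row2P; rewrite !mxE /= addrC.
  by rewrite cosD2pi cosN acosK.
by rewrite sinD2pi sinN sx ltr0_norm ?opprK.
Qed.

(** * The slide curve as a Lipschitz image of a level set *)

Lemma enorm_row_mx (R : realType) m n (u : 'rV[R]_m) (v : 'rV[R]_n) :
  enorm (row_mx u v) <= enorm u + enorm v.
Proof.
apply: enorm_le; first by rewrite addr_ge0 ?enorm_ge0.
rewrite /dotp big_split_ord /=.
under eq_bigr do rewrite row_mxEl.
under [X in _ + X]eq_bigr do rewrite row_mxEr.
rewrite -!/(dotp _ _) -!enorm_sqr sqrrD.
by rewrite addrAC lerDl mulrn_wge0// mulr_ge0 ?enorm_ge0.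
Qed.

(** Moving from [P] towards [Q] leaves [H] at once, since such a point violates
    the variational inequality. *)
Lemma nearest_point_boundary (R : realType) n (H : set 'rV[R]_n) Q P :
  nearest_point H Q P -> Q != P -> boundary H P.
Proof.
move=> [HP nP] QP; split; first exact: subset_closure.
have QP0 : 0 < enorm (Q - P).
  by rewrite lt0r enorm_ge0 andbT; apply: contra_neq QP => /enorm_eq0/subr0_eq.
rewrite /interior /= => /nbhs_normP[d /= d0 dH].
pose t := d / (enorm (Q - P) *+ 2).
have t0 : 0 < t by rewrite divr_gt0// pmulrn_lgt0.
have /nP : H (P + t *: (Q - P)).
  apply: dH => /=; rewrite opprD addrA subrr add0r normrN normrZ gtr0_norm//.
  apply: (le_lt_trans (ler_wpM2l (ltW t0) (norm_le_enorm _))).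
  rewrite /t -mulr_natr invfM mulrA mulrAC divfK ?gt_eqF//.
  by rewrite ltr_pdivrMr// mulr_natr mulr2n ltrDl.
rewrite (addrC P) addrK dotpZr -enorm_sqr leNgt.
by rewrite mulr_gt0 ?exprn_gt0.
Qed.

(** The second component is the direction of the supporting line with outer
    normal [Q - nearest H Q]: the quarter turn is counterclockwise, since [H]
    has to lie on the left of the line. *)
Definition slide (R : realType) (H : set 'rV[R]_2) (Q : 'rV[R]_2) :
    'rV[R]_(2 + 2) := row_mx (nearest H Q) (rot (Q - nearest H Q)).

Lemma left_halfplane_dotp (R : realType) (l : directed_line)
    (P q n : 'rV[R]_2) :
  rot n = dir l -> line l P -> left_halfplane l q <-> dotp n (q - P) <= 0.
Proof.
move=> nl [t ->]; rewrite /left_halfplane /= -nl dotp2E !mxE /=.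
by split; lra.
Qed.

Lemma slide_inj (R : realType) (H : set 'rV[R]_2) : injective (slide H).
Proof.
move=> Q Q' /eq_row_mx[pp]; rewrite pp => /rot_inj.
exact: addIr.
Qed.

Lemma unit_circle_enorm (R : realType) (v : 'rV[R]_2) :
  unit_circle v <-> enorm v = 1.
Proof.
rewrite /unit_circle /= !expr2 -dotp2E -enorm_sqr; split => [|->].
  by rewrite enorm_sqr => v1; apply: enormP => //; rewrite v1 expr1n.
by rewrite expr1n.
Qed.

Lemma rotNK (R : realType) (u : 'rV[R]_2) : rot (- rot u) = u.
Proof. by apply: row2P; rewrite !mxE//= opprK. Qed.

Lemma Sli_slide (R : realType) (H : set 'rV[R]_2) :
  H !=set0 -> compact H -> convex_set H ->
  Sli H = slide H @` [set Q | dist_to H Q = 1].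
Proof.
move=> H0 cH vH; apply/seteqP; split => [_ [P [l [[bP [Hl _] lP] ->]]]|].
  pose n := - rot (dir l).
  have nl : rot n = dir l by exact: rotNK.
  have n1 : enorm n = 1.
    by rewrite enormN enorm_rot; apply/unit_circle_enorm/dir_unit.
  have HP : H P by apply: (compact_closed (@norm_hausdorff _ _) cH); case: bP.
  have PnP : nearest_point H (P + n) P.
    split=> // h /Hl; rewrite (left_halfplane_dotp _ nl lP).
    by rewrite (addrC P) addrK.
  have pP := nearest_eq H0 cH vH PnP.
  exists (P + n); first by rewrite /= dist_to.unlock pP (addrC P) addrK.
  by rewrite /slide pP (addrC P) addrK nl.
move=> _ [Q /= Q1 <-].
have [HP nP] := nearestP H0 cH vH Q.
have u1 : unit_circle (rot (Q - nearest H Q)).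
  by apply/unit_circle_enorm; rewrite enorm_rot -Q1 dist_to.unlock.
pose l := DirectedLine (nearest H Q) u1.
have nl : rot (Q - nearest H Q) = dir l by [].
exists (nearest H Q), l; split=> //.
have lP : line l (nearest H Q).
  by exists 0; rewrite scale0r addr0.
split=> //.
  apply: (nearest_point_boundary (nearestP H0 cH vH Q)).
  apply/eqP => QP; move: Q1.
  rewrite dist_to.unlock -QP subrr enorm0 => /esym/eqP.
  by rewrite oner_eq0.
split; last by exists (nearest H Q).
by move=> h Hh; apply/(left_halfplane_dotp h nl lP)/nP.
Qed.

Lemma slide_lipschitz (R : realType) (H : set 'rV[R]_2) (Q Q' : 'rV[R]_2) :
  H !=set0 -> compact H -> convex_set H ->
  enorm (slide H Q - slide H Q') <= 3 * enorm (Q - Q').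
Proof.
move=> H0 cH vH; rewrite /slide opp_row_mx add_row_mx.
have nonexp :=
  nearest_point_nonexpansive (nearestP H0 cH vH Q) (nearestP H0 cH vH Q').
rewrite (le_trans (enorm_row_mx _ _))// -rotB enorm_rot.
set P := nearest H Q in nonexp *; set P' := nearest H Q' in nonexp *.
have -> : Q - P - (Q' - P') = (Q - Q') - (P - P').
  by rewrite !opprB addrACA [RHS]addrACA (addrC (- Q')).
have := enormD (Q - Q') (- (P - P')); rewrite enormN.
by move: nonexp; lra.
Qed.

Theorem theorem3p1 (R : realType) (H : set 'rV[R]_2) :
  H !=set0 -> compact H -> convex_set H ->
  rectifiable_simple_closed_curve (Sli H).
Proof.
move=> H0 cH vH; have [c Hc] := H0.
have [k k0 kP] := radial_lipschitz H0 cH vH Hc.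
pose g t := slide H (radial H c (circle t)).
have g_lip s t : enorm (g s - g t) <= (3 * k) * `|s - t|.
  rewrite (le_trans (slide_lipschitz _ _ H0 cH vH))// -mulrA ler_wpM2l//.
  rewrite (le_trans (kP _ _ _ _)) ?enorm_circle//.
  by rewrite ler_wpM2l ?circle_lipschitz.
have gT : g 0 = g (pi *+ 2) by rewrite /g circle_2pi.
have k3 : 0 <= 3 * k by rewrite mulr_ge0.
exists 0, (pi *+ 2), g; split; last exact: lipschitz_rectifiable k3 g_lip.
split=> //.
- by rewrite pmulrn_lgt0// pi_gt0.
- apply: continuous_subspaceT; apply: (@lipschitz_continuous R R _ g (3 * k)).
  by move=> s t; rewrite (le_trans (norm_le_enorm _)).
- move=> s t sI tI /slide_inj /(radial_inj H0 cH vH Hc).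
  by move=> /(_ (enorm_circle _) (enorm_circle _)) /circle_inj; exact.
rewrite Sli_slide//; apply/seteqP; split=> [_ [t _ <-]|_ [Q /= Q1 <-]].
  exists (radial H c (circle t)) => //.
  by have [] := radiusP H0 cH vH Hc (enorm_circle t).
have [e /circle_surj[t tI <-] <-] := radial_surj H0 cH vH Hc Q1.
exists t => //=; move: tI; rewrite !in_itv/= => /andP[-> /ltW ->] //.
Qed.
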